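(* For $\theta\in[0,1]$, let $C^{\mathrm{N7}}_\theta(u,v)=\max\{\theta uv+(1-\theta)(u+v-1),\,0\}$, $(u,v)\in[0,1]^2$. Then Chatterjee's rank correlation of $C^{\mathrm{N7}}_\theta$ is $$\xi\left(C^{\mathrm{N7}}_\theta\right)=1-\theta.$$
   Context: For a bivariate copula $C$, Chatterjee's rank correlation is $\xi(C)=6\int_0^1\int_0^1(\partial_1C(u,v))^2\,du\,dv-2$, where $\partial_1C$ is the (almost everywhere defined) partial derivative of $C$ with respect to its first argument. *)

(* Defs.v *)
From HB Require Import structures.
From mathcomp Require Import all_boot all_order all_algebra.
From mathcomp Require Import all_classical all_reals all_analysis.
From mathcomp Require Import ring lra.

Set Implicit Arguments.
Unset Strict Implicit.
Unset Printing Implicit Defensive.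

Import Order.TTheory GRing.Theory Num.Theory.
Import numFieldNormedType.Exports.

Local Open Scope classical_set_scope.
Local Open Scope ring_scope.

(* A bivariate copula is a function on the unit square; it is represented by a
   function on the whole plane of which only the values on [0,1]^2 matter. *)
Record is_copula (R : realType) (C : R -> R -> R) : Prop := IsCopula {
  copula_grounded_l : forall v, 0 <= v <= 1 -> C 0 v = 0;
  copula_grounded_r : forall u, 0 <= u <= 1 -> C u 0 = 0;
  copula_margin_l : forall v, 0 <= v <= 1 -> C 1 v = v;
  copula_margin_r : forall u, 0 <= u <= 1 -> C u 1 = u;
  copula_2increasing : forall u1 u2 v1 v2,
    0 <= u1 -> u1 <= u2 -> u2 <= 1 -> 0 <= v1 -> v1 <= v2 -> v2 <= 1 ->
    0 <= C u2 v2 - C u2 v1 - C u1 v2 + C u1 v1 }.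

Record copula (R : realType) := Copula {
  copula_fun :> R -> R -> R;
  copulaP : is_copula copula_fun }.

(* The derivative is total: where the section t |-> C t v is not differentiable
   it has an unspecified value. For each v in [0,1] this happens, for u in
   ]0,1[, only on a Lebesgue-null set; the endpoints u = 0 and u = 1, where the
   values of C outside the square would intervene, are negligible too. *)
Definition partial1 (R : realType) (C : R -> R -> R) (u v : R) : R :=
  derive1 (fun t : R => C t v) u.

Definition chatterjee_xi (R : realType) (C : copula R) : R :=
  6 * (\int[@lebesgue_measure R]_(v in `[0, 1])
         (\int[@lebesgue_measure R]_(u in `[0, 1]) (partial1 C u v) ^+ 2)) - 2.

Definition N7 (R : realType) (theta u v : R) : R :=
  Num.max (theta * u * v + (1 - theta) * (u + v - 1)) 0.

Lemma N7_is_copula (R : realType) (theta : R) :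
  0 <= theta <= 1 -> is_copula (N7 theta).
Proof.
move=> /andP[t0 t1]; split; rewrite /N7.
- by move=> v /andP[v0 v1]; apply/max_idPr; nra.
- by move=> u /andP[u0 u1]; apply/max_idPr; nra.
- move=> v /andP[v0 v1].
  have -> : theta * 1 * v + (1 - theta) * (1 + v - 1) = v by lra.
  exact/max_idPl.
- move=> u /andP[u0 u1].
  have -> : theta * u * 1 + (1 - theta) * (u + 1 - 1) = u by lra.
  exact/max_idPl.
move=> u1 u2 v1 v2 u10 u12 u21 v10 v12 v21.
pose f (u v : R) := theta * u * v + (1 - theta) * (u + v - 1).
rewrite -!/(f _ _).
have fl u u' v : 0 <= v -> u <= u' -> f u v <= f u' v.
  move=> v0 uu'; rewrite -subr_ge0.
  have -> : f u' v - f u v = (theta * v + (1 - theta)) * (u' - u).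
    by rewrite /f; ring.
  by rewrite mulr_ge0 ?subr_ge0// addr_ge0 ?subr_ge0// mulr_ge0.
have fr u v v' : 0 <= u -> v <= v' -> f u v <= f u v'.
  move=> u0 vv'; rewrite -subr_ge0.
  have -> : f u v' - f u v = (theta * u + (1 - theta)) * (v' - v).
    by rewrite /f; ring.
  by rewrite mulr_ge0 ?subr_ge0// addr_ge0 ?subr_ge0// mulr_ge0.
have vol : 0 <= f u2 v2 - f u2 v1 - f u1 v2 + f u1 v1.
  have -> : f u2 v2 - f u2 v1 - f u1 v2 + f u1 v1 =
            theta * ((u2 - u1) * (v2 - v1)) by rewrite /f; ring.
  by rewrite !mulr_ge0 ?subr_ge0.
have a := fl _ _ _ v10 u12.
have b := fl _ _ _ (le_trans v10 v12) u12.
have c := fr _ _ _ u10 v12.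
have d := fr _ _ _ (le_trans u10 u12) v12.
by case: (lerP (f u1 v1) 0) => ?; case: (lerP (f u2 v1) 0) => ?;
   case: (lerP (f u1 v2) 0) => ?; case: (lerP (f u2 v2) 0) => ?; lra.
Qed.

Definition copulaN7 (R : realType) (theta : R) (htheta : 0 <= theta <= 1) :
  copula R := Copula (N7_is_copula htheta).

(* Main.v *)
Require Import Defs.
From mathcomp Require Import all_boot all_order all_algebra.
From mathcomp Require Import all_classical all_reals all_analysis.
From mathcomp Require Import ring lra.

Import Order.TTheory GRing.Theory Num.Theory.
Import numFieldNormedType.Exports.
Local Open Scope ring_scope.

(** Fix v and put s = theta v + 1 - theta and u0 = (1 - theta)(1 - v) / s, which
    lies in [0,1]. The section u |-> C(u, v) is the hinge max(s (u - u0), 0), whose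
    derivative is s to the right of u0 and 0 to its left, so the inner integral
    is s^2 (1 - u0) = s v = theta v^2 + (1 - theta) v. Integrating over v gives
    theta / 3 + (1 - theta) / 2. *)

Lemma derive1_affine (R : realType) (s x0 x : R) :
  derive1 (fun t : R => s * (t - x0)) x = s.
Proof.
rewrite derive1E deriveM// deriveB// derive_id !derive_cst.
by rewrite subr0 scaler0 addr0 /GRing.scale/= mulr1.
Qed.

(** A derivative depends only on values near the point, and strictly to the right of the kink the
    hinge agrees locally with its affine branch. *)
Lemma derive1_hinge_gt (R : realType) (s x0 x : R) : 0 <= s -> x0 < x ->
  derive1 (fun t : R => Num.max (s * (t - x0)) 0) x = s.
Proof.
move=> s0 x0x; rewrite -[RHS](@derive1_affine R s x0 x) !derive1E.
apply: near_eq_derive; near=> t; apply/max_idPl.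
rewrite mulr_ge0// subr_ge0 ltW//; near: t; exact: lt_nbhsr.
Unshelve. all: by end_near. Qed.

Lemma derive1_hinge_lt (R : realType) (s x0 x : R) : 0 <= s -> x < x0 ->
  derive1 (fun t : R => Num.max (s * (t - x0)) 0) x = 0.
Proof.
move=> s0 xx0; rewrite -[RHS](@derive1_cst _ _ (0 : R) x) !derive1E.
apply: near_eq_derive; near=> t; apply/max_idPr.
rewrite mulr_ge0_le0// subr_le0 ltW//; near: t; exact: lt_nbhsl.
Unshelve. all: by end_near. Qed.

(** The value [f x0] is left free because the derivative of a hinge need not exist at its kink; a
    single point has measure zero. *)
Lemma Rintegral_step (R : realType) (f : R -> R) (a b x0 c : R) :
  a <= x0 <= b ->
  (forall x, a <= x < x0 -> f x = 0) -> (forall x, x0 < x <= b -> f x = c) ->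
  \int[@lebesgue_measure R]_(x in `[a, b]) f x = c * (b - x0).
Proof.
move=> /andP[ax xb] f0 fc.
have fint : (@lebesgue_measure R).-integrable `[a, b] (EFin \o f).
  (* Integrability comes from a combination of indicators equal to [f] on the whole interval; the
     singleton term absorbs the arbitrary value at [x0]. *)
  pose g x : R := c * \1_`]x0, b] x + f x0 * \1_`[x0, x0] x.
  have gf x : x \in `[a, b]%classic -> g x = f x.
    rewrite inE/= in_itv/= /g => /andP[ax' xb'].
    rewrite !indicE !mem_setE !in_itv/= xb' andbT; case: (ltgtP x0 x) => x0x.
    - by rewrite (fc x) ?x0x//=; ring.
    - by rewrite (f0 x) ?ax'//=; ring.
    - by rewrite -x0x/=; ring.
  apply: (@eq_integrable _ _ R (@lebesgue_measure R) _ (measurable_itv _)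
    (EFin \o g)) => /=.
    by move=> x /gf/= ->.
  apply: (@integrableS _ _ R (@lebesgue_measure R) [set: R]) => //.
  rewrite (_ : EFin \o g = (fun x => c%:E * (\1_`]x0, b] x)%:E) \+
    (fun x => (f x0)%:E * (\1_`[x0, x0] x)%:E))%E//.
  by apply: integrableD => //; apply: integrableZl => //;
    exact: integrable_indic_itv.
have := @Rintegral_itvB R f (BLeft a) (BRight b) x0 fint.
rewrite !bnd_simp => /(_ ax xb) fB.
have l0 : \int[@lebesgue_measure R]_(x in `[a, x0]) f x = 0.
  (* Opening the right endpoint discards [x0], where nothing is known about [f]. *)
  rewrite -Rintegral_itv_bndo_bndc; last first.
    apply: integrableS fint => //; apply: subset_itvl.
    by rewrite bnd_simp.
  rewrite (@eq_Rintegral _ _ _ _ _ (cst 0)) ?Rintegral_cst ?mul0r//.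
  by move=> x; rewrite inE/= in_itv/= => /f0.
move: fB; rewrite l0 subr0 => ->.
rewrite (@eq_Rintegral _ _ _ _ _ (cst c)); last first.
  by move=> x; rewrite inE/= in_itv/= => /fc.
rewrite Rintegral_cst//= lebesgue_measure_itv/= lte_fin.
(* The remaining case is [x0 = b]: the right piece is empty and [b - x0] vanishes. *)
case: ifP => //= /negbT; rewrite -leNgt => bx0.
by rewrite (le_anti (introT andP (conj xb bx0))) subrr.
Qed.

Lemma Rintegral_FTC (R : realType) (f F : R -> R) (a b : R) : a < b ->
  continuous f -> (forall x, is_derive x (1 : R) F (f x)) ->
  \int[@lebesgue_measure R]_(x in `[a, b]) f x = F b - F a.
Proof.
move=> ab cf dF.
have cF : continuous F.
  by move=> x; apply/differentiable_continuous/derivable1_diffP; case: (dF x).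
rewrite /Rintegral (@continuous_FTC2 _ _ F)//.
- exact: continuous_subspaceT.
- split; first by move=> x _; case: (dF x).
  + exact/cvg_at_right_filter/cF.
  + exact/cvg_at_left_filter/cF.
- by move=> x _; rewrite derive1E; case: (dF x).
Qed.

Lemma N7_hinge (R : realType) (theta u v : R) : 0 <= theta <= 1 -> 0 <= v <= 1 ->
  N7 theta u v = Num.max ((theta * v + (1 - theta)) *
    (u - (1 - theta) * (1 - v) / (theta * v + (1 - theta)))) 0.
Proof.
move=> /andP[t0 t1] /andP[v0 v1]; rewrite /N7; congr Num.max.
have [s0|s0] := eqVneq (theta * v + (1 - theta)) 0; last by field.
have /eqP := s0; rewrite paddr_eq0 ?mulr_ge0 ?subr_ge0//.
(* Here theta = 1 and v = 0, and the division by 0 is harmless. *)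
move=> /andP[/eqP tv /eqP t1E].
by rewrite s0 t1E mulrAC tv !mul0r addr0.
Qed.

Lemma Rintegral_partial1_N7_sqr (R : realType) (theta v : R) :
  0 <= theta <= 1 -> 0 <= v <= 1 ->
  \int[@lebesgue_measure R]_(u in `[0, 1]) (partial1 (N7 theta) u v) ^+ 2 =
  theta * v ^+ 2 + (1 - theta) * v.
Proof.
move=> t01 v01; have /andP[t0 t1] := t01; have /andP[v0 v1] := v01.
rewrite /partial1.
(* The hinge form holds for every real [t], so whole functions are equal and the derivative can be
   rewritten at every [u]. *)
under [fun t : R => N7 theta t v]funext => t do rewrite N7_hinge//.
set s := theta * v + (1 - theta); set k := (1 - theta) * (1 - v).
have s0 : 0 <= s by rewrite addr_ge0 ?mulr_ge0 ?subr_ge0.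
(* In fact [s - k = v]. *)
have ks : k <= s by rewrite /k /s; nra.
have k0 : 0 <= k by rewrite mulr_ge0 ?subr_ge0.
have x0 : 0 <= k / s <= 1.
  rewrite divr_ge0//=; move: s0; rewrite le_eqVlt => /predU1P[<-|s0].
    by rewrite invr0 mulr0.
  by rewrite ler_pdivrMr// mul1r.
rewrite (@Rintegral_step _ _ _ _ (k / s) (s ^+ 2))//.
(* For nonzero [s], [s ^+ 2 * (1 - k / s) = s * (s - k) = s * v]; for [s = 0] both sides vanish. *)
- have [s00|sn0] := eqVneq s 0; last by rewrite /k /s in sn0 *; field.
  have -> : theta * v ^+ 2 + (1 - theta) * v = s * v by rewrite /s; ring.
  by rewrite s00; ring.
- by move=> u /andP[_ ux]; rewrite derive1_hinge_lt// expr0n.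
- by move=> u /andP[xu _]; rewrite derive1_hinge_gt.
Qed.

Theorem mainTheorem9 (R : realType) (theta : R) (htheta : 0 <= theta <= 1) :
  chatterjee_xi (copulaN7 htheta) = 1 - theta.
Proof.
rewrite /chatterjee_xi/=.
rewrite (@eq_Rintegral _ _ R (@lebesgue_measure R) _
  (fun v : R => theta * v ^+ 2 + (1 - theta) * v));
  last first.
  move=> v; rewrite inE/= in_itv/=; exact: Rintegral_partial1_N7_sqr.
pose F (v : R) := theta / 3 * v ^+ 3 + (1 - theta) / 2 * v ^+ 2.
have dF (v : R) : is_derive v (1 : R) F (theta * v ^+ 2 + (1 - theta) * v).
  by apply: is_derive_eq; rewrite /GRing.scale/=; field.
rewrite (@Rintegral_FTC _ _ _ _ _ _ _ dF)//; first by rewrite /F; field.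
move=> v; apply: cvgD; apply: cvgM; try exact: cvg_cst; last exact: cvg_id.
exact: exprn_continuous.
Qed.
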